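(* Let $\Lambda_{TT}=\{(F(x),\Lambda_x,v(x))\}_{x\in X}$ be a continuous $(T,T)$-controlled $g$-fusion Bessel family for $H$ with bound $B$, $\Gamma_{UU}=\{(G(x),\Gamma_x,w(x))\}_{x\in X}$ a continuous $(U,U)$-controlled $g$-fusion Bessel family for $H$ with bound $D$, $m\in L^\infty(X,\mu)$, and let $M_{m,\Lambda T,\Gamma U}$ be the continuous $(T,U)$-controlled $g$-fusion Bessel multiplier of $\Lambda_{TT}$, $\Gamma_{UU}$ and $m$. Assume that there is $\lambda\in(0,1)$ such that $$\|f-M_{m,\Lambda T,\Gamma U}f\|\le\lambda\|f\|\qquad\text{for all } f\in H.$$ Then $\Lambda_{TT}$ is a continuous $(T,T)$-controlled $g$-fusion frame for $H$ and $\Gamma_{UU}$ is a continuous $(U,U)$-controlled $g$-fusion frame for $H$.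
   Context: $H$ is a separable Hilbert space, $\mathbb H$ is the collection of all closed subspaces of $H$, and $(X,\mu)$ is a measure space with positive measure $\mu$; $d\mu_x$ denotes integration with respect to $\mu$ in the variable $x$. $P_M$ is the orthogonal projection of $H$ onto a closed subspace $M$ (when followed by an operator defined on $M$ it is regarded as a map $H\to M$; its adjoint is then the inclusion $M\to H$). An operator is positive if it is self-adjoint and $\langle Sf,f\rangle\ge 0$ for all $f$; $\mathcal{GB}^+(H)$ is the set of positive bounded operators on $H$ with bounded inverse. Here $T,U\in\mathcal{GB}^+(H)$; $F,G:X\to\mathbb H$ are weakly measurable (for each $f\in H$, $x\mapsto P_{F(x)}f$ and $x\mapsto P_{G(x)}f$ are measurable); $v,w:X\to\mathbb R^+$ are measurable; $\{K_x\}_{x\in X}$ are Hilbert spaces; and $\Lambda_x:F(x)\to K_x$, $\Gamma_x:G(x)\to K_x$ are bounded linear for each $x\in X$. $\Lambda_{TT}$ is a continuous $(T,T)$-controlled $g$-fusion frame for $H$ if there are $0<A\le B<\infty$ with $A\|f\|^2\le\int_X v^2(x)\langle\Lambda_xP_{F(x)}Tf,\Lambda_xP_{F(x)}Tf\rangle\,d\mu_x\le B\|f\|^2$ for all $f\in H$; it is a Bessel family with bound $B$ if the right-hand inequality holds. Similarly for $\Gamma_{UU}$ with $G,\Gamma_x,w,U$ in place of $F,\Lambda_x,v,T$. The continuous $(T,U)$-controlled $g$-fusion Bessel multiplier of $\Lambda_{TT}$, $\Gamma_{UU}$ and $m$ is the bounded operator on $H$ defined by $\langle M_{m,\Lambda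 T,\Gamma U}f,g\rangle=\int_X m(x)v(x)w(x)\langle TP_{F(x)}\Lambda_x^*\Gamma_xP_{G(x)}Uf,g\rangle\,d\mu_x$ for $f,g\in H$. The integrands occurring here are understood to be measurable. *)

(* Defs.v *)
From HB Require Import structures.
From mathcomp Require Import all_boot all_order all_algebra.
From mathcomp Require Import all_classical all_reals all_analysis ess_sup_inf.
From mathcomp Require Import complex.

Set Implicit Arguments.
Unset Strict Implicit.
Unset Printing Implicit Defensive.

Import Order.TTheory GRing.Theory Num.Theory.
Import numFieldNormedType.Exports.

Local Open Scope classical_set_scope.
Local Open Scope ring_scope.

(* Hilbert spaces are taken over either of the two classical scalar fields. *)
Variant scalar_kind := RealScalars | ComplexScalars.

Definition hscalar (R : realType) (c : scalar_kind) : numFieldType :=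
  match c with RealScalars => R | ComplexScalars => R[i] end.

Section Scalars.
Context (R : realType) (c : scalar_kind).

Definition sconj : {rmorphism hscalar R c -> hscalar R c} :=
  match c return {rmorphism hscalar R c -> hscalar R c} with
  | RealScalars => (idfun : {rmorphism R -> R})
  | ComplexScalars => (@conjc R : {rmorphism R[i] -> R[i]})
  end.

Definition sRe : hscalar R c -> R :=
  match c return hscalar R c -> R with
  | RealScalars => fun z => z
  | ComplexScalars => fun z => complex.Re z
  end.

Definition sIm : hscalar R c -> R :=
  match c return hscalar R c -> R with
  | RealScalars => fun=> 0
  | ComplexScalars => fun z => complex.Im z
  end.

(* a + i b over C; over R the imaginary part is dropped *)
Definition sMk (a b : R) : hscalar R c :=
  match c return hscalar R c with
  | RealScalars => a
  | ComplexScalars => (a +i* b)%C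
  end.

Definition sreal (a : R) : hscalar R c := sMk a 0.

(* The norm of an element of a normed space over [hscalar] is itself an element
   of [hscalar]; [rnorm] is the same number, as an element of R. *)
Definition rnorm (V : normedModType (hscalar R c)) (f : V) : R := sRe `|f|.

Definition sabs (z : hscalar R c) : R := sRe `|z|.

Section Integral.
Context d (X : measurableType d) (mu : {measure set X -> \bar R}).

Definition hmeasurable (h : X -> hscalar R c) : Prop :=
  measurable_fun [set: X] (fun x => sRe (h x)) /\
  measurable_fun [set: X] (fun x => sIm (h x)).

Definition hintegral (h : X -> hscalar R c) : hscalar R c :=
  sMk (\int[mu]_x sRe (h x)) (\int[mu]_x sIm (h x)).

Definition Linfty (h : X -> hscalar R c) : Prop :=
  hmeasurable h /\ (ess_sup mu (fun x => (sabs (h x))%:E) < +oo)%E.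

End Integral.
End Scalars.

(* The inner product is linear in its first argument and conjugate linear in
   its second one. *)
Record hilbertType (R : realType) (c : scalar_kind) := Hilbert {
  hilbert_sort :> completeNormedModType (hscalar R c) ;
  ip : {dot hilbert_sort for sconj R c} ;
  ip_norm : forall f : hilbert_sort, ip f f = `|f| ^+ 2 }.

Definition separable_space (T : topologicalType) : Prop :=
  exists2 D : set T, countable D & dense D.

Section ClosedSubspaces.
Context (R : realType) (c : scalar_kind) (H : hilbertType R c).

Record closed_subspace := ClosedSubspace {
  cs_pred : {pred H} ;
  cs_submod : submod_closed cs_pred ;
  cs_closed : closed [set` cs_pred] }.

HB.instance Definition _ (M : closed_subspace) :=
  GRing.isSubmodClosed.Build (hscalar R c) H (cs_pred M) (cs_submod M).

Record csub (M : closed_subspace) := CSub {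
  csval :> H ; _ : csval \in cs_pred M }.

HB.instance Definition _ (M : closed_subspace) := [isSub for @csval M].
HB.instance Definition _ (M : closed_subspace) := [Choice of csub M by <:].
HB.instance Definition _ (M : closed_subspace) :=
  [SubChoice_isSubLmodule of csub M by <:].

(* The orthogonal projection P_M, as a map H -> M: the unique u in M such that
   f - u is orthogonal to M. *)
Definition orthproj (M : closed_subspace) (f : H) : csub M :=
  xget 0 [set u : csub M |
           forall v : csub M, ip H (f - csval u) (csval v) = 0].

(* The adjoint K -> M of L : M -> K, for the inner product of H restricted
   to M. *)
Definition adjoint (M : closed_subspace) (K : hilbertType R c)
    (L : csub M -> K) (k : K) : csub M :=
  xget 0 [set u : csub M |
           forall v : csub M, ip K (L v) k = ip H (csval v) (csval u)].

Definition bounded_from (M : closed_subspace) (K : hilbertType R c)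
    (L : csub M -> K) : Prop :=
  exists C : R, forall u : csub M, rnorm (L u) <= C * rnorm (csval u).

Definition bounded_operator (T : H -> H) : Prop :=
  exists C : R, forall f : H, rnorm (T f) <= C * rnorm f.

(* Over C, [0 <= z] also says that z is real. *)
Definition positive_op (T : H -> H) : Prop :=
  (forall f g : H, ip H (T f) g = ip H f (T g)) /\
  (forall f : H, 0 <= ip H (T f) f).

Definition GBplus (T : {linear H -> H}) : Prop :=
  [/\ bounded_operator T, positive_op T &
      exists S : {linear H -> H}, [/\ bounded_operator S, cancel T S & cancel S T]].

Section Families.
Context d (X : measurableType d) (mu : {measure set X -> \bar R}).
Implicit Types (F G : X -> closed_subspace) (K : X -> hilbertType R c).

(* H carries its Borel sigma-algebra. *)
Definition weakly_measurable F : Prop :=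
  forall f : H, measurable_fun [set: X]
    ((fun x => csval (orthproj (F x) f)) : X -> g_sigma_algebraType (@open H)).

(* v(x)^2 <Lambda_x P_F(x) T f, Lambda_x P_F(x) T f> *)
Definition frame_integrand F K (Lam : forall x, {linear csub (F x) -> K x})
    (v : X -> R) (T : {linear H -> H}) (f : H) (x : X) : R :=
  v x ^+ 2 * sRe (ip (K x) (Lam x (orthproj (F x) (T f)))
                           (Lam x (orthproj (F x) (T f)))).

Definition gfusion_bessel F K (Lam : forall x, {linear csub (F x) -> K x})
    (v : X -> R) (T : {linear H -> H}) (B : R) : Prop :=
  forall f : H,
    (\int[mu]_x (frame_integrand Lam v T f x)%:E <= (B * rnorm f ^+ 2)%:E)%E.

Definition gfusion_frame F K (Lam : forall x, {linear csub (F x) -> K x})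
    (v : X -> R) (T : {linear H -> H}) : Prop :=
  exists A B : R, [/\ 0 < A, A <= B & forall f : H,
    ((A * rnorm f ^+ 2)%:E <= \int[mu]_x (frame_integrand Lam v T f x)%:E)%E /\
    (\int[mu]_x (frame_integrand Lam v T f x)%:E <= (B * rnorm f ^+ 2)%:E)%E].

(* m(x) v(x) w(x) <T P_F(x) Lambda_x^* Gamma_x P_G(x) U f, g> *)
Definition multiplier_integrand F G K
    (Lam : forall x, {linear csub (F x) -> K x}) (v : X -> R)
    (T : {linear H -> H})
    (Gam : forall x, {linear csub (G x) -> K x}) (w : X -> R)
    (U : {linear H -> H})
    (m : X -> hscalar R c) (f g : H) (x : X) : hscalar R c :=
  m x * sreal c (v x) * sreal c (w x) *
  ip H (T (csval (orthproj (F x) (csval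
         (adjoint (Lam x) (Gam x (orthproj (G x) (U f)))))))) g.

Definition is_multiplier F G K
    (Lam : forall x, {linear csub (F x) -> K x}) (v : X -> R)
    (T : {linear H -> H})
    (Gam : forall x, {linear csub (G x) -> K x}) (w : X -> R)
    (U : {linear H -> H})
    (m : X -> hscalar R c) (M : {linear H -> H}) : Prop :=
  bounded_operator M /\
  forall f g : H,
    ip H (M f) g = hintegral mu (multiplier_integrand Lam v T Gam w U m f g).

End Families.
End ClosedSubspaces.

(* Main.v *)
Require Import Defs.
From mathcomp Require Import all_boot all_order all_algebra.
From mathcomp Require Import all_classical all_reals all_analysis.
From mathcomp Require Import complex ess_sup_inf measurable_realfun ring lra.

Set Implicit Arguments.
Unset Strict Implicit.
Unset Printing Implicit Defensive.

Import Order.TTheory GRing.Theory Num.Theory.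
Import numFieldNormedType.Exports.

Local Open Scope classical_set_scope.
Local Open Scope ring_scope.

(** Testing the multiplier against the vector it is applied to gives

      Re <M f, f> = Re <f, f> - Re <f - M f, f> >= (1 - lam) |f|^2.

    On the other side, <M f, f> is an integral of terms that factor through
    the two families: since T is self-adjoint, and P_F(x) and Lambda_x^* can be
    moved to the second argument, the integrand at x is
    m(x) v(x) w(x) <Gamma_x P_G(x) U f, Lambda_x P_F(x) T f>.
    By Cauchy-Schwarz and the inequality a b <= t a^2 + b^2 / t, its real part
    is at most C times t (frame integrand of Lambda) + t^-1 (frame integrand of
    Gamma), where C bounds |m| almost everywhere. Writing I(f) and J(f) for the
    two frame integrals, for every t > 0

      (1 - lam) |f|^2 <= C (t I(f) + t^-1 J(f)).

    Since J(f) <= D |f|^2, a large t makes the second term at most half of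
    the left-hand side, and what remains bounds I(f) below by a multiple of
    |f|^2; a small t does the same for J(f) ([lower_bound_of_balance]). The
    free parameter t replaces the Cauchy-Schwarz inequality for integrals.

    The analytic input is the projection theorem ([orthprojP]): the projection
    on a closed subspace is a choice of a vector with the right property,
    and such a vector must be shown to exist before P_F(x) can be moved across
    the inner product. The adjoint of Lambda_x is a choice of the same kind, but
    its existence is not at stake: where the choice falls back on its default
    value 0, the integrand is 0 and the estimate is trivial. *)

(** * Real parts and moduli of scalars *)

Section ScalarTheory.
Context (R : realType) (c : scalar_kind).
Implicit Types (z : hscalar R c) (a : R).

Lemma sReD z1 z2 : sRe (z1 + z2) = sRe z1 + sRe z2.
Proof. by case: c z1 z2 => // -[? ?] [? ?]. Qed.

Lemma sReN z : sRe (- z) = - sRe z.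
Proof. by case: c z => // -[? ?]. Qed.

Lemma sRe0 : sRe (0 : hscalar R c) = 0.
Proof. by case: c. Qed.

Lemma sRe_conj z : sRe (sconj R c z) = sRe z.
Proof. by case: c z => // -[? ?]. Qed.

Lemma sRe_realM a z : sRe (sreal c a * z) = a * sRe z.
Proof. by case: c z => // -[x y] /=; rewrite mul0r subr0. Qed.

Lemma le_sRe z1 z2 : z1 <= z2 -> sRe z1 <= sRe z2.
Proof. by case: c z1 z2 => // -[? ?] [? ?]; rewrite lecE => /andP[]. Qed.

Lemma lt_sRe z1 z2 : z1 < z2 -> sRe z1 < sRe z2.
Proof. by case: c z1 z2 => // -[? ?] [? ?]; rewrite ltcE => /andP[]. Qed.

Lemma sRe_real a : sRe (sreal c a) = a.
Proof. by case: c. Qed.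

Lemma sreal_ge0 z : 0 <= z -> z = sreal c (sRe z).
Proof. by case: c z => // -[x y]; rewrite lecE /= => /andP[/eqP -> _]. Qed.

Lemma sconj_real a : sconj R c (sreal c a) = sreal c a.
Proof. by case: c => //=; rewrite oppr0. Qed.

Lemma lt_sreal a b : (sreal c a < sreal c b) = (a < b).
Proof. by case: c => //=; rewrite ltcE /= eqxx. Qed.

Lemma sreal_gt0 a : (0 < sreal c a) = (0 < a).
Proof. by case: c => //=; rewrite ltcE /= eqxx. Qed.

Lemma sabs_real a : sabs (sreal c a) = `|a|.
Proof.
rewrite /sabs; case: c => //=.
by rewrite expr0n addr0 sqrtr_sqr.
Qed.

Lemma sabs_ge0 z : 0 <= sabs z.
Proof. by rewrite -sRe0; exact/le_sRe/normr_ge0. Qed.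

Lemma sabsM z1 z2 : sabs (z1 * z2) = sabs z1 * sabs z2.
Proof.
by rewrite /sabs normrM (sreal_ge0 (normr_ge0 z1)) sRe_realM sRe_real.
Qed.

Lemma sabs_eq0 z : sabs z = 0 -> z = 0.
Proof.
move=> z0; apply/eqP/normr0P; rewrite (sreal_ge0 (normr_ge0 z)) -/(sabs z) z0.
by case: c {z z0}.
Qed.

Lemma sRe_sqr_norm z : sRe (`|z| ^+ 2) = sabs z ^+ 2.
Proof. by rewrite /sabs (sreal_ge0 (normr_ge0 z)) expr2 sRe_realM sRe_real. Qed.

Lemma sconj_normM z : z * sconj R c z = `|z| ^+ 2.
Proof.
case: c z => [z|z]; last exact: (esym (sqr_normc _)).
by rewrite /= -normrX ger0_norm ?sqr_ge0// expr2.
Qed.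

End ScalarTheory.

(** * The inner product and the real-valued norm *)

Section InnerProduct.
Context (R : realType) (c : scalar_kind) (H : hilbertType R c).
Implicit Types (f g h : H) (z : hscalar R c).

Lemma ipDl f g h : ip H (f + g) h = ip H f h + ip H g h.
Proof. exact: linearDl. Qed.

Lemma ipNl f g : ip H (- f) g = - ip H f g.
Proof. exact: linearNl. Qed.

Lemma ipZl z f g : ip H (z *: f) g = z * ip H f g.
Proof. exact: linearZl_LR. Qed.

Lemma ipC f g : ip H f g = sconj R c (ip H g f).
Proof. by rewrite (hermC (ip H)) expr0 mul1r. Qed.

Lemma ipDr f g h : ip H f (g + h) = ip H f g + ip H f h.
Proof. exact: linearDr. Qed.

Lemma ipNr f g : ip H f (- g) = - ip H f g.
Proof. exact: linearNr. Qed.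

Lemma ipZr z f g : ip H f (z *: g) = sconj R c z * ip H f g.
Proof. exact: linearZr_LR. Qed.

Lemma ip0l f : ip H 0 f = 0.
Proof. exact: linear0l. Qed.

End InnerProduct.

Section Norm.
Context (R : realType) (c : scalar_kind) (H : hilbertType R c).
Implicit Types (f g h : H) (z : hscalar R c).

Lemma rnorm_ge0 f : 0 <= rnorm f.
Proof. by rewrite -(sRe0 R c); exact/le_sRe/normr_ge0. Qed.

Lemma norm_rnorm f : `|f| = sreal c (rnorm f).
Proof. exact/sreal_ge0/normr_ge0. Qed.

Lemma rnormN f : rnorm (- f) = rnorm f.
Proof. by rewrite /rnorm normrN. Qed.

Lemma ler_rnormD f g : rnorm (f + g) <= rnorm f + rnorm g.
Proof. by rewrite /rnorm -sReD; exact/le_sRe/ler_normD. Qed.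

Lemma rnormZ z f : rnorm (z *: f) = sabs z * rnorm f.
Proof. by rewrite /rnorm normrZ (sreal_ge0 (normr_ge0 z)) sRe_realM. Qed.

Lemma rnorm_sqr f : rnorm f ^+ 2 = sRe (ip H f f).
Proof.
by rewrite ip_norm norm_rnorm [in RHS]expr2 sRe_realM sRe_real expr2.
Qed.

Lemma rnorm_sqrD f g :
  rnorm (f + g) ^+ 2 = rnorm f ^+ 2 + 2 * sRe (ip H f g) + rnorm g ^+ 2.
Proof.
rewrite !rnorm_sqr !ipDl !ipDr !sReD (ipC g f) sRe_conj; ring.
Qed.

(** The norm of the space is given together with its triangle inequality, so
    Cauchy-Schwarz for the real part is read off from the square of the
    latter. *)
Lemma Re_ip_le f g : sRe (ip H f g) <= rnorm f * rnorm g.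
Proof.
have := ler_rnormD f g.
rewrite -(ler_pXn2r (n := 2)) ?nnegrE ?addr_ge0 ?rnorm_ge0//.
by rewrite rnorm_sqrD sqrrD; lra.
Qed.

Lemma abs_Re_ip_le f g : `|sRe (ip H f g)| <= rnorm f * rnorm g.
Proof.
rewrite ler_norml Re_ip_le andbT lerNl -sReN -ipNl -(rnormN f); exact: Re_ip_le.
Qed.

Lemma parallelogram f g :
  rnorm (f + g) ^+ 2 + rnorm (f - g) ^+ 2 = 2 * (rnorm f ^+ 2 + rnorm g ^+ 2).
Proof. rewrite !rnorm_sqrD rnormN ipNr sReN; ring. Qed.

End Norm.

(** * Orthogonal projection on a closed subspace *)

Section Projection.
Context (R : realType) (c : scalar_kind) (H : hilbertType R c).
Context (M : closed_subspace H).
Implicit Types (f g u v : H).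

(** By the parallelogram identity, two vectors whose distances to [f] nearly
    reach the lower bound [delta] are close to each other, because their
    midpoint still lies in the subspace. *)
Lemma approx_minimizers_close f u v (delta e : R) :
    u \in cs_pred M -> v \in cs_pred M ->
    0 <= delta -> 0 <= e ->
    (forall w, w \in cs_pred M -> delta <= rnorm (f - w)) ->
    rnorm (f - u) <= delta + e -> rnorm (f - v) <= delta + e ->
  rnorm (u - v) ^+ 2 <= 8 * delta * e + 4 * e ^+ 2.
Proof.
move=> uM vM d0 e0 dmin ue ve.
have mid :
    rnorm ((f - u) + (f - v)) = 2 * rnorm (f - 2^-1 *: (u + v)).
  have two : sabs (2 : hscalar R c) = 2.
    rewrite /sabs ger0_norm//; by case: c => //=; rewrite ?addr0.
  rewrite -[X in X * rnorm _]two -rnormZ; congr rnorm.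
  rewrite scalerBr scalerA mulfV ?pnatr_eq0// scale1r scaler_nat mulr2n.
  by rewrite opprD addrACA.
have wM : 2^-1 *: (u + v) \in cs_pred M by rewrite rpredZ// rpredD.
have par := parallelogram (f - u) (f - v).
have diff : (f - u) - (f - v) = - (u - v) by rewrite !opprB addrC addrA subrK.
rewrite mid diff rnormN in par.
have := dmin _ wM.
have := rnorm_ge0 (f - u); have := rnorm_ge0 (f - v).
move: par ue ve; set a := rnorm _; set b := rnorm _.
set p := rnorm _; set q := rnorm _.
move=> par ue ve q0 p0 db.
have : p ^+ 2 <= (delta + e) ^+ 2 by rewrite ler_pXn2r ?nnegrE// addr_ge0.
have : q ^+ 2 <= (delta + e) ^+ 2 by rewrite ler_pXn2r ?nnegrE// addr_ge0.
nra.
Qed.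

(** A minimizing sequence for the distance is Cauchy by
    [approx_minimizers_close]; its limit stays in the closed subspace and
    attains the infimum. *)
Lemma exists_nearest f : exists2 u, u \in cs_pred M &
  forall v, v \in cs_pred M -> rnorm (f - u) <= rnorm (f - v).
Proof.
pose E := [set rnorm (f - v) | v in [set` cs_pred M]].
pose delta := inf E.
have E0 : E !=set0 by exists (rnorm (f - 0)), 0 => //=; rewrite rpred0.
have Elb : has_lbound E by exists 0 => _ [v _ <-]; exact: rnorm_ge0.
have d0 : 0 <= delta by apply: lb_le_inf => // _ [v _ <-]; exact: rnorm_ge0.
have dmin v : v \in cs_pred M -> delta <= rnorm (f - v).
  by move=> vM; apply: ge_inf => //; exists v.
have /choice[u_ u_P] n :
    exists u, u \in cs_pred M /\ rnorm (f - u) < delta + n.+1%:R^-1.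
  have [|_ [u uM <-] ue] := @inf_adherent _ E (n.+1%:R^-1) _ (conj E0 Elb).
    by rewrite invr_gt0.
  by exists u.
have u_M n : u_ n \in cs_pred M by case: (u_P n).
have near_small (e : R) :
    0 < e -> \forall n \near \oo, rnorm (f - u_ n) <= delta + e.
  move=> e0; near=> n; apply/ltW; case: (u_P n) => _ /lt_le_trans; apply.
  rewrite lerD2l ltW//; near: n; exact: near_infty_natSinv_lt (PosNum e0).
have : cauchy (u_ @ \oo).
  apply: cauchy_exP => eps eps0.
  have e0 : 0 < sRe eps by rewrite -(sRe0 R c) lt_sRe.
  (* As e <= 1, 8 delta e + 4 e^2 <= (8 delta + 4) e, which is < eps^2. *)
  pose e := Num.min 1 (sRe eps ^+ 2 / (8 * delta + 5)).
  have den0 : 0 < 8 * delta + 5 by lra.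
  have ep : 0 < e by rewrite lt_min ltr01 divr_gt0// exprn_gt0.
  have [N _ Ne] := near_small e ep.
  exists (u_ N); exists N => // n /= Nn.
  rewrite -ball_normE /= norm_rnorm (sreal_ge0 (ltW eps0)) lt_sreal.
  rewrite -(ltr_pXn2r (n := 2)) ?nnegrE ?rnorm_ge0// ?ltW//.
  have := approx_minimizers_close (u_M N) (u_M n) d0 (ltW ep) dmin
    (Ne _ (leqnn N)) (Ne _ Nn).
  move=> /le_lt_trans; apply.
  have e1 : e <= 1 by rewrite ge_min lexx.
  have e2 : e * (8 * delta + 5) <= sRe eps ^+ 2.
    by rewrite -ler_pdivlMr// ge_min lexx orbT.
  nra.
move=> /cauchy_cvg /cvg_ex[u ul].
exists u.
  apply: (@closed_cvg _ _ \oo _ u_ _ (@cs_closed _ _ _ M) _ u ul).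
  by near=> n; exact: u_M.
move=> v vM; apply: le_trans (dmin v vM).
apply/ler_addgt0Pr => e e0.
have he0 : 0 < e / 2 by rewrite divr_gt0.
have she0 : 0 < sreal c (e / 2) by rewrite sreal_gt0.
move/cvgrPdist_lt: ul => /(_ _ she0) ul.
near \oo => n.
have -> : f - u = (f - u_ n) + (- (u - u_ n)) by rewrite opprB addrA subrK.
apply: le_trans (ler_rnormD _ _) _.
rewrite rnormN (splitr e) addrA lerD//.
  near: n; exact: near_small.
apply/ltW; rewrite -(lt_sreal c) -norm_rnorm; near: n; exact: ul.
Unshelve. all: by end_near. Qed.

(** Moving [u] by [s * a * v] with [a] the inner product of [f - u] and [v]
    and [s > 0] changes the squared distance by
    [- 2 s |a|^2 + s^2 |a|^2 |v|^2], which is negative for small [s] unless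
    [a = 0]. *)
Lemma nearest_orthogonal f u : u \in cs_pred M ->
    (forall v, v \in cs_pred M -> rnorm (f - u) <= rnorm (f - v)) ->
  forall v, v \in cs_pred M -> ip H (f - u) v = 0.
Proof.
move=> uM umin v vM; set a := ip H (f - u) v.
(* Any s > 0 with s |v|^2 < 2 would do; the summand 1 covers v = 0. *)
pose s := (rnorm v ^+ 2 + 1)^-1.
have n0 : 0 <= rnorm v ^+ 2 by exact: sqr_ge0.
have s0 : 0 < s by rewrite invr_gt0; lra.
have sn : s * rnorm v ^+ 2 <= 1 by rewrite mulrC ler_pdivrMr; lra.
have wM : u + (sreal c s * a) *: v \in cs_pred M by rewrite rpredD// rpredZ.
have := umin _ wM; rewrite opprD addrA.
rewrite -(ler_pXn2r (n := 2)) ?nnegrE ?rnorm_ge0//.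
rewrite [leRHS]rnorm_sqrD rnormN ipNr sReN.
rewrite ipZr -/a rmorphM /= sconj_real -mulrA (mulrC _ a) sconj_normM sRe_realM.
rewrite sRe_sqr_norm rnormZ sabsM sabs_real gtr0_norm// => h.
have a0 := sabs_ge0 a.
have : sabs a ^+ 2 <= 0.
  rewrite -(pmulr_rle0 _ s0).
  have : (s * sabs a * rnorm v) ^+ 2 <= s * sabs a ^+ 2; last by nra.
  have -> : (s * sabs a * rnorm v) ^+ 2 =
    (s * sabs a ^+ 2) * (s * rnorm v ^+ 2) by ring.
  by rewrite ler_piMr// mulr_ge0 ?sqr_ge0// ltW.
move=> h0; have : sabs a ^+ 2 = 0 by apply/le_anti; rewrite h0 sqr_ge0.
by move/eqP; rewrite sqrf_eq0 => /eqP; exact: sabs_eq0.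
Qed.

Lemma orthprojP f (v : csub M) :
  ip H (f - csval (orthproj M f)) (csval v) = 0.
Proof.
have [u uM umin] := exists_nearest f.
suff /(xgetPex 0) : exists u : csub M,
    forall v : csub M, ip H (f - csval u) (csval v) = 0 by exact.
exists (CSub uM) => -[w wM]; exact: (nearest_orthogonal uM umin).
Qed.

Lemma orthproj_id (u : csub M) : csval (orthproj M (csval u)) = csval u.
Proof.
pose d := u - orthproj M (csval u).
have := orthprojP (csval u) d.
have -> : csval d = csval u - csval (orthproj M (csval u)).
  exact: (raddfB (val : csub M -> H)).
by rewrite ip_norm => /eqP; rewrite sqrf_eq0 normr_eq0 subr_eq0 => /eqP.
Qed.

Lemma ip_orthproj (u : csub M) g :
  ip H (csval u) g = ip H (csval u) (csval (orthproj M g)).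
Proof.
by apply/eqP; rewrite -subr_eq0 -ipNr -ipDr ipC orthprojP rmorph0.
Qed.

End Projection.

(** * Estimates on the multiplier *)

Section Multiplier.
Context (R : realType) (c : scalar_kind) (H : hilbertType R c).
Context (d : measure_display) (X : measurableType d).
Context (mu : {measure set X -> \bar R}) (K : X -> hilbertType R c).
Implicit Types (F G : X -> closed_subspace H) (T U : {linear H -> H}).
Implicit Types (v w : X -> R).

Lemma frame_integrandE F (Lam : forall x, {linear csub (F x) -> K x})
    v T f x :
  frame_integrand Lam v T f x =
  (v x * rnorm (Lam x (orthproj (F x) (T f)))) ^+ 2.
Proof. by rewrite /frame_integrand -rnorm_sqr exprMn. Qed.

Lemma frame_integrand_ge0 F (Lam : forall x, {linear csub (F x) -> K x})
    v T f x :
  0 <= frame_integrand Lam v T f x.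
Proof. by rewrite frame_integrandE sqr_ge0. Qed.

(** Moving T, P_F(x) and Lambda_x^* to the second argument turns the integrand
    into the inner product of Gamma_x P_G(x) U f and Lambda_x P_F(x) T g in
    K_x, to which Cauchy-Schwarz applies. *)
Lemma multiplier_integrand_le F G
    (Lam : forall x, {linear csub (F x) -> K x}) v T
    (Gam : forall x, {linear csub (G x) -> K x}) w U
    (m : X -> hscalar R c) f g x :
    (forall f g, ip H (T f) g = ip H f (T g)) -> 0 <= v x -> 0 <= w x ->
  `|sRe (multiplier_integrand Lam v T Gam w U m f g x)| <=
  sabs (m x) * ((v x * rnorm (Lam x (orthproj (F x) (T g)))) *
                (w x * rnorm (Gam x (orthproj (G x) (U f))))).
Proof.
move=> Tsym vx wx; rewrite /multiplier_integrand orthproj_id Tsym ip_orthproj.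
set p := orthproj (F x) (T g); set k := Gam x _.
have rhs0 : 0 <= sabs (m x) * ((v x * rnorm (Lam x p)) * (w x * rnorm k)).
  by rewrite !mulr_ge0 ?sabs_ge0 ?rnorm_ge0.
(* If no adjoint vector exists, [adjoint] is 0 and so is the integrand. *)
rewrite /adjoint; case: xgetP => [u _ /(_ p) up|_]; last first.
  by rewrite [csval 0](raddf0 (val : csub (F x) -> H)) ip0l mulr0 sRe0 normr0.
have -> : m x * sreal c (v x) * sreal c (w x) * ip H (csval u) (csval p) =
    sreal c (v x) * (sreal c (w x) * ip (K x) (m x *: k) (Lam x p)).
  by rewrite ipZl (ipC k) up -ipC; ring.
rewrite !sRe_realM !normrM (ger0_norm vx) (ger0_norm wx).
have := abs_Re_ip_le (m x *: k) (Lam x p); rewrite rnormZ => h.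
have -> : sabs (m x) * (v x * rnorm (Lam x p) * (w x * rnorm k)) =
  v x * (w x * (sabs (m x) * rnorm k * rnorm (Lam x p))) by ring.
by rewrite !ler_wpM2l.
Qed.

(** [k] may have infinite integral: the real-valued integral of [h], even if
    it is the junk value 0, is at most the extended integral of [|h|]. *)
Lemma le_Rintegral_ae (h k : X -> R) :
    measurable_fun [set: X] h -> measurable_fun [set: X] k ->
    (forall x, 0 <= k x) -> {ae mu, forall x, `|h x| <= k x} ->
  ((\int[mu]_x h x)%:E <= \int[mu]_x (k x)%:E)%E.
Proof.
move=> mh mk k0 hk.
have fine_le (y : \bar R) : ((fine y)%:E <= `|y|)%E.
  by case: y => [r| |]//=; rewrite ?lee_fin ?ler_norm ?leey.
apply: le_trans (fine_le _) _; apply: le_trans (le_abse_integral _ _ _) _ => //.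
  exact/measurable_EFinP.
apply: ae_ge0_le_integral => //.
- by apply: measurableT_comp => //; exact/measurable_EFinP.
- by move=> x _; rewrite lee_fin.
- exact/measurable_EFinP.
- by apply: filterS hk => x hkx _; rewrite lee_fin.
Qed.

(** The parameter [t] weights the two families against each other, as in
    2 a b <= t a^2 + b^2 / t; choosing it later spares taking square roots of
    integrals. *)
Lemma multiplier_form_le F G (Lam : forall x, {linear csub (F x) -> K x}) v T
    (Gam : forall x, {linear csub (G x) -> K x}) w U (m : X -> hscalar R c)
    (M : {linear H -> H}) (C : R) f g (t : R) :
    (forall f g, ip H (T f) g = ip H f (T g)) ->
    (forall x, 0 <= v x) -> (forall x, 0 <= w x) ->
    measurable_fun [set: X] (frame_integrand Lam v T g) ->
    measurable_fun [set: X] (frame_integrand Gam w U f) ->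
    hmeasurable (multiplier_integrand Lam v T Gam w U m f g) ->
    is_multiplier mu Lam v T Gam w U m M ->
    0 <= C -> {ae mu, forall x, sabs (m x) <= C} -> 0 < t ->
  ((sRe (ip H (M f) g))%:E <=
   C%:E * (t%:E * \int[mu]_x (frame_integrand Lam v T g x)%:E +
           t^-1%:E * \int[mu]_x (frame_integrand Gam w U f x)%:E))%E.
Proof.
move=> Tsym v0 w0 mL mG [mRe _] [_ ->] C0 mC t0.
have s0 : 0 < t^-1 by rewrite invr_gt0.
rewrite /hintegral.
have -> (a b : R) : sRe (sMk c a b) = a by case: (c).
have L0 x := frame_integrand_ge0 Lam v T g x.
have G0 x := frame_integrand_ge0 Gam w U f x.
set L := frame_integrand Lam v T g in mL L0 *.
set J := frame_integrand Gam w U f in mG G0 *.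
have EL : (t%:E * \int[mu]_x (L x)%:E = \int[mu]_x (t * L x)%:E)%E.
  rewrite -ge0_integralZl_EFin//; [|exact/measurable_EFinP|exact: ltW].
  by move=> x _; rewrite lee_fin.
have EJ : (t^-1%:E * \int[mu]_x (J x)%:E = \int[mu]_x (t^-1 * J x)%:E)%E.
  rewrite -ge0_integralZl_EFin//; [|exact/measurable_EFinP|exact: ltW].
  by move=> x _; rewrite lee_fin.
have mtL : measurable_fun [set: X] (fun x => t * L x) by exact: measurable_funM.
have mtJ : measurable_fun [set: X] (fun x => t^-1 * J x).
  exact: measurable_funM.
have tL0 x : 0 <= t * L x by rewrite mulr_ge0// ltW.
have tJ0 x : 0 <= t^-1 * J x by rewrite mulr_ge0// ltW.
rewrite EL EJ -ge0_integralD//; last 4 first.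
- by move=> x _; rewrite lee_fin.
- exact/measurable_EFinP.
- by move=> x _; rewrite lee_fin.
- exact/measurable_EFinP.
rewrite -ge0_integralZl_EFin//; last 2 first.
- by move=> x _; rewrite -EFinD lee_fin addr_ge0.
- by apply/measurable_EFinP; exact: measurable_funD.
apply: (@le_Rintegral_ae _ (fun x => C * (t * L x + t^-1 * J x))) => //.
- by apply: measurable_funM => //; exact: measurable_funD.
- by move=> x; rewrite mulr_ge0 ?addr_ge0.
apply: filterS mC => x mC.
apply: le_trans (multiplier_integrand_le Lam Gam U m f g Tsym (v0 x) (w0 x)) _.
rewrite ler_pM ?sabs_ge0 ?mulr_ge0 ?rnorm_ge0// /L /J !frame_integrandE.
set a := _ * rnorm _; set b := _ * rnorm _.
(* The square is 2 a b <= t a^2 + t^-1 b^2 in disguise. *)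
have : 0 <= t^-1 * (t * a - b) ^+ 2 by rewrite mulr_ge0 ?sqr_ge0 ?ltW.
have -> : t^-1 * (t * a - b) ^+ 2 = t * a ^+ 2 + t^-1 * b ^+ 2 - 2 * (a * b).
  by field; rewrite gt_eqF.
have : 0 <= a by rewrite mulr_ge0 ?rnorm_ge0.
have : 0 <= b by rewrite mulr_ge0 ?rnorm_ge0.
nra.
Qed.

End Multiplier.

Lemma perturbed_identity_form_ge (R : realType) (c : scalar_kind)
    (H : hilbertType R c) (M : {linear H -> H}) (lam : R) (f : H) :
    rnorm (f - M f) <= lam * rnorm f ->
  (1 - lam) * rnorm f ^+ 2 <= sRe (ip H (M f) f).
Proof.
move=> h; have := Re_ip_le (f - M f) f.
rewrite ipDl ipNl sReD sReN -rnorm_sqr.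
have := rnorm_ge0 f; nra.
Qed.

(** * Frame bounds *)

(** Choosing [t] so large that [C * t^-1 * J] is at most half of [a * n] leaves
    [a * n / 2 <= C * t * I]. The constant depends only on [a], [C] and [D], so
    it is uniform over all vectors. *)
Lemma lower_bound_of_balance (R : realType) (a C D : R) :
    0 < a -> 0 < C -> exists2 A : R, 0 < A &
  forall (n : R) (I J : \bar R), 0 <= n -> (0 <= I)%E -> (0 <= J)%E ->
    (J <= (D * n)%:E)%E ->
    (forall t : R, 0 < t ->
      ((a * n)%:E <= C%:E * (t%:E * I + t^-1%:E * J))%E) ->
  ((A * n)%:E <= I)%E.
Proof.
move=> a0 C0.
(* t below must be positive even when D is not. *)
pose D' := Num.max D 1.
have D'0 : 0 < D' by rewrite lt_max ltr01 orbT.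
pose t := 2 * C * D' / a.
have t0 : 0 < t by rewrite divr_gt0// !mulr_gt0.
exists (a / (2 * C * t)); first by rewrite divr_gt0// mulr_gt0// mulr_gt0.
move=> n I J n0 I0 J0 JD /(_ t t0).
case: I I0 => [I| |]; [|by move=> _ _; rewrite leey|by rewrite leeNy_eq].
case: J J0 JD => [J| |]; [|by rewrite leye_eq|by rewrite leeNy_eq].
rewrite 2!lee_fin => J0 JD I0 balE.
have bal : a * n <= C * (t * I + t^-1 * J) by rewrite -lee_fin; exact: balE.
rewrite lee_fin.
have JD' : J <= D' * n by apply: le_trans JD _; rewrite ler_wpM2r// le_max lexx.
rewrite mulrAC ler_pdivrMr; last by rewrite mulr_gt0// mulr_gt0.
have CJ : C * (t^-1 * J) <= a * n / 2.
  have -> : a * n / 2 = C * (t^-1 * (D' * n)).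
    by rewrite /t; field; rewrite !gt_eqF.
  by rewrite !ler_wpM2l ?invr_ge0// ltW.
nra.
Qed.
Theorem theorem4p9
  (R : realType) (c : scalar_kind) (H : hilbertType R c)
  (d : measure_display) (X : measurableType d) (mu : {measure set X -> \bar R})
  (K : X -> hilbertType R c)
  (T U : {linear H -> H})
  (F G : X -> closed_subspace H)
  (v w : X -> R)
  (Lam : forall x : X, {linear csub (F x) -> K x})
  (Gam : forall x : X, {linear csub (G x) -> K x})
  (m : X -> hscalar R c) (M : {linear H -> H}) (B D lam : R)
  (sepH : separable_space H)
  (hT : GBplus T) (hU : GBplus U)
  (hF : weakly_measurable F) (hG : weakly_measurable G)
  (hv : measurable_fun [set: X] v) (v0 : forall x, 0 <= v x)
  (hw : measurable_fun [set: X] w) (w0 : forall x, 0 <= w x)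
  (hLam : forall x, bounded_from (Lam x))
  (hGam : forall x, bounded_from (Gam x))
  (mLam : forall f, measurable_fun [set: X] (frame_integrand Lam v T f))
  (mGam : forall f, measurable_fun [set: X] (frame_integrand Gam w U f))
  (mM : forall f g, hmeasurable (multiplier_integrand Lam v T Gam w U m f g))
  (besselLam : gfusion_bessel mu Lam v T B)
  (besselGam : gfusion_bessel mu Gam w U D)
  (hm : Linfty mu m)
  (hM : is_multiplier mu Lam v T Gam w U m M)
  (lam0 : 0 < lam) (lam1 : lam < 1)
  (hlam : forall f : H, rnorm (f - M f) <= lam * rnorm f) :
  gfusion_frame mu Lam v T /\ gfusion_frame mu Gam w U.
Proof.
have [_ [Tsym _] _] := hT.
have [C0 mC0] := ess_supr_bounded hm.2.
pose C := Num.max C0 1.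
have Cpos : 0 < C by rewrite lt_max ltr01 orbT.
have mC : {ae mu, forall x, sabs (m x) <= C}.
  by apply: filterS mC0 => x /le_trans; apply; rewrite le_max lexx.
have a0 : 0 < 1 - lam by rewrite subr_gt0.
have n0 (f : H) : 0 <= rnorm f ^+ 2 by exact: sqr_ge0.
have balance (f : H) (t : R) : 0 < t ->
    (((1 - lam) * rnorm f ^+ 2)%:E <=
     C%:E * (t%:E * \int[mu]_x (frame_integrand Lam v T f x)%:E +
             t^-1%:E * \int[mu]_x (frame_integrand Gam w U f x)%:E))%E.
  move=> t0.
  have := multiplier_form_le Tsym v0 w0 (mLam f) (mGam f) (mM f f) hM
    (ltW Cpos) mC t0.
  apply: le_trans; rewrite lee_fin; exact/perturbed_identity_form_ge/hlam.
have LamI0 (f : H) : (0 <= \int[mu]_x (frame_integrand Lam v T f x)%:E)%E.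
  by apply: integral_ge0 => x _; rewrite lee_fin frame_integrand_ge0.
have GamI0 (f : H) : (0 <= \int[mu]_x (frame_integrand Gam w U f x)%:E)%E.
  by apply: integral_ge0 => x _; rewrite lee_fin frame_integrand_ge0.
have frame_of_lower (A E : R) (I : H -> \bar R) : 0 < A ->
    (forall f, ((A * rnorm f ^+ 2)%:E <= I f)%E) ->
    (forall f, (I f <= (E * rnorm f ^+ 2)%:E)%E) ->
    exists A B : R, [/\ 0 < A, A <= B & forall f : H,
      ((A * rnorm f ^+ 2)%:E <= I f)%E /\ (I f <= (B * rnorm f ^+ 2)%:E)%E].
  move=> A0 lo up; exists A, (Num.max A E); split => //.
    by rewrite le_max lexx.
  move=> f; split => //; apply: le_trans (up f) _.
  by rewrite lee_fin ler_wpM2r// le_max lexx orbT.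
split.
- have [A A0 lo] := lower_bound_of_balance D a0 Cpos.
  apply: frame_of_lower A0 _ besselLam => f.
  by apply: lo (besselGam f) _ => // t; exact: balance.
- have [A A0 lo] := lower_bound_of_balance B a0 Cpos.
  apply: frame_of_lower A0 _ besselGam => f.
  apply: lo (besselLam f) _ => // t t0.
  have := balance f t^-1; rewrite invr_gt0 invrK addeC; exact.
Qed.
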